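(* A groupoid $(Q,\cdot)$ is a commutative pentagonal quasigroup if and only if there exists an Abelian group $(Q,+)$ of exponent $11$ on the set $Q$ (that is, $11x=0$ for all $x\in Q$) such that $x\cdot y=6x+6y$ for all $x,y\in Q$.
   Context: A groupoid is a nonempty set with a binary operation. A pentagonal quasigroup is a quasigroup satisfying the identities $xx=x$, $\;(xy)(zu)=(xz)(yu)$ and $\big(((xy)x)y\big)x=y$. It is commutative if $xy=yx$ for all $x,y$. ''Exponent $11$'' is understood as $11x=0$ for all $x$, so the trivial one-element group is allowed. *)

(* Defs.v *)
From mathcomp Require Import all_boot.

Set Implicit Arguments.
Unset Strict Implicit.
Unset Printing Implicit Defensive.

Definition quasigroup (Q : Type) (mul : Q -> Q -> Q) : Prop :=
  (forall a b, exists! x, mul a x = b) /\ (forall a b, exists! y, mul y a = b).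

Record pentagonal_quasigroup (Q : Type) (mul : Q -> Q -> Q) : Prop :=
  PentagonalQuasigroup {
    pq_quasigroup : quasigroup mul;
    pq_idempotent : forall x, mul x x = x;
    pq_medial : forall x y z u,
      mul (mul x y) (mul z u) = mul (mul x z) (mul y u);
    pq_pentagonal : forall x y, mul (mul (mul (mul x y) x) y) x = y
  }.

(* MathComp's [zmodType] bundles a choice structure on the carrier, which an
   arbitrary set [Q] need not come with; hence this unbundled predicate. *)
Record abelian_group (Q : Type) (zero : Q) (opp : Q -> Q)
    (add : Q -> Q -> Q) : Prop := AbelianGroup {
  ag_addA : associative add;
  ag_addC : commutative add;
  ag_add0 : left_id zero add;
  ag_addN : left_inverse zero opp add
}.

(* The multiple n x = x + (... + (x + 0)), with n summands x. *)
Definition nmul (Q : Type) (zero : Q) (add : Q -> Q -> Q) (n : nat) (x : Q) : Q :=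
  iter n (add x) zero.

(* Main.v *)
Require Import Defs.
From mathcomp Require Import all_boot.

(** In an Abelian group of exponent 11, multiplication by 6 is halving, because
    12x = x; so xy = 6x + 6y is the midpoint of x and y.  Hence
    xy = 6(x + y), and the quasigroup, idempotent and medial laws hold for
    midpoints in every Abelian group where every element has a unique half.  The
    number 11 matters for the pentagonal law: its left-hand side is the
    combination of x and y with coefficients 0 and 1 modulo 11
    ([midpoint_pentagonal]).

    Conversely, choose a base point o, to become zero.  If xy is to be the
    midpoint of x and y, then [half x = ox] must be halving and x + y must be
    twice xy.  Idempotence and mediality make [half] an endomorphism of the
    product.  The pentagonal law at (o, y) reads half (half (half y) * y) = y,
    so [half] has an explicit inverse, [double y = half (half y) * y], and
    x + y can be defined by a term in the product, with no choice of solutions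
    of equations.  Associativity of + follows from mediality after applying
    [half] twice.  The formula for [double], evaluated at 4y, says 8y = y * 4y,
    and doubling it gives 16y = y + 4y = 5y ([nmul16]); cancellation
    yields 11y = 0.  Then 12x = x identifies [half x] with 6x, and
    xy = half x + half y is the required formula. *)

(** * Multiples in commutative monoids *)

Section Multiples.

Context (Q : Type) (zero : Q) (add : Q -> Q -> Q).
Context (addA : associative add) (addC : commutative add)
  (add0 : left_id zero add).

Local Notation nmul := (nmul zero add).

Lemma add_interchange : interchange add add.
Proof. by move=> x y z t; rewrite -!addA [add y _]addA [add y z]addC !addA. Qed.

Lemma nmulDl m n x : nmul (m + n) x = add (nmul m x) (nmul n x).
Proof. by elim: m => [|m IHm] /=; rewrite ?add0 // -addA -IHm. Qed.

Lemma nmul0 n : nmul n zero = zero.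
Proof. by elim: n => //= n ->; rewrite add0. Qed.

Lemma nmulDr n x y : nmul n (add x y) = add (nmul n x) (nmul n y).
Proof. by elim: n => [|n IHn] /=; rewrite ?add0 // IHn add_interchange. Qed.

Lemma nmulM m n x : nmul (m * n) x = nmul m (nmul n x).
Proof. by elim: m => //= m IHm; rewrite mulSn nmulDl IHm. Qed.

Lemma nmul1 x : nmul 1 x = x.
Proof. by rewrite /= addC add0. Qed.

End Multiples.

(** * Midpoints in groups of exponent 11 *)

Section Midpoint.

Context (Q : Type) (zero : Q) (opp : Q -> Q) (add : Q -> Q -> Q).
Context (ag : abelian_group zero opp add).

Local Notation nmul := (nmul zero add).

Context (exp11 : forall x, nmul 11 x = zero).

Let addA := ag_addA ag.
Let addC := ag_addC ag.
Let add0 := ag_add0 ag.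
Let addN := ag_addN ag.

Local Notation mul x y := (add (nmul 6 x) (nmul 6 y)).

Lemma nmul_modn m x : nmul m x = nmul (m %% 11) x.
Proof.
rewrite [in LHS](divn_eq m 11) (nmulDl _ _ _ addA add0).
by rewrite (nmulM _ _ _ addA add0) exp11 (nmul0 _ _ _ add0) add0.
Qed.

Lemma nmul_eqmod m n x : m = n %[mod 11] -> nmul m x = nmul n x.
Proof. by move=> eq_mn; rewrite nmul_modn eq_mn -nmul_modn. Qed.

Lemma nmul2K : cancel (nmul 2) (nmul 6).
Proof.
move=> x; rewrite -(nmulM _ _ _ addA add0) -[RHS](nmul1 _ _ _ addC add0).
exact: nmul_eqmod.
Qed.

Lemma nmul6K : cancel (nmul 6) (nmul 2).
Proof.
move=> x; rewrite -(nmulM _ _ _ addA add0) -[RHS](nmul1 _ _ _ addC add0).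
exact: nmul_eqmod.
Qed.

Lemma midpointE x y : mul x y = nmul 6 (add x y).
Proof. by rewrite (nmulDr _ _ _ addA addC add0). Qed.

Lemma midpointC x y : mul x y = mul y x.
Proof. exact: addC. Qed.

Lemma midpointxx x : mul x x = x.
Proof.
rewrite -(nmulDl _ _ _ addA add0) -[RHS](nmul1 _ _ _ addC add0).
exact: nmul_eqmod.
Qed.

Lemma midpoint_medial x y z u : mul (mul x y) (mul z u) = mul (mul x z) (mul y u).
Proof. by rewrite !midpointE (add_interchange _ _ addA addC). Qed.

(** The solution of ax = b is the reflection of a in b, that is 2b - a. *)
Lemma midpoint_solve a b : exists! x, mul a x = b.
Proof.
exists (add (opp a) (nmul 2 b)); split.
  rewrite midpointE addA [add a _]addC addN add0; exact: nmul2K.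
move=> x <-; rewrite midpointE nmul6K addA addN; exact: add0.
Qed.

Lemma midpoint_quasigroup : quasigroup (fun x y => mul x y).
Proof.
split=> a b; first exact: midpoint_solve.
have [x [ax_b x_uniq]] := midpoint_solve a b.
exists x; split=> [|y]; rewrite midpointC //; exact: x_uniq.
Qed.

(** Words in x and y are evaluated through their coefficients. *)
Lemma midpoint_comb a b c d x y :
  mul (add (nmul a x) (nmul b y)) (add (nmul c x) (nmul d y)) =
  add (nmul (6 * (a + c)) x) (nmul (6 * (b + d)) y).
Proof.
rewrite midpointE (add_interchange _ _ addA addC) -!(nmulDl _ _ _ addA add0).
by rewrite (nmulDr _ _ _ addA addC add0) -!(nmulM _ _ _ addA add0).
Qed.

Lemma midpoint_pentagonal x y : mul (mul (mul (mul x y) x) y) x = y.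
Proof.
have ex : x = add (nmul 1 x) (nmul 0 y).
  by rewrite (nmul1 _ _ _ addC add0) [RHS]addC add0.
have ey : y = add (nmul 0 x) (nmul 1 y).
  by rewrite (nmul1 _ _ _ addC add0) [RHS]add0.
set X := add (nmul 1 x) _ in ex; set Y := add (nmul 0 x) _ in ey.
transitivity (mul (mul (mul (mul X Y) X) Y) X); first by rewrite -ex -ey.
(* The successive coefficient pairs are (6,6), (9,3), (10,2), (0,1) mod 11. *)
rewrite !midpoint_comb [RHS]ey /Y.
by congr add; apply: nmul_eqmod.
Qed.

Lemma midpoint_pentagonal_quasigroup :
  pentagonal_quasigroup (fun x y => mul x y).
Proof.
split.
- exact: midpoint_quasigroup.
- exact: midpointxx.
- exact: midpoint_medial.
- exact: midpoint_pentagonal.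
Qed.

End Midpoint.

(** * The group of a commutative pentagonal quasigroup *)

Section PentagonalGroup.

Context (Q : Type) (mul : Q -> Q -> Q) (o : Q).
Context (pq : pentagonal_quasigroup mul) (mulC : commutative mul).

Let mulxx := pq_idempotent pq.
Let mul_medial := pq_medial pq.

Definition half x := mul o x.

(** The pentagonal law supplies this term for the inverse of [half], so that
    the sum of x and y, twice their midpoint, is a term in the product. *)
Definition double x := mul (half (half x)) x.
Definition padd x y := double (mul x y).

Local Notation nmul := (nmul o padd).

Lemma pq_mulI a : injective (mul a).
Proof.
move=> x y eq_axy; have [z [_ z_uniq]] := (pq_quasigroup pq).1 a (mul a y).
by rewrite -(z_uniq x eq_axy) -(z_uniq y).
Qed.

Lemma halfM x y : half (mul x y) = mul (half x) (half y).
Proof. by rewrite /half mul_medial mulxx. Qed.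

(** This is the pentagonal law at the pair (o, y). *)
Lemma doubleK : cancel double half.
Proof.
move=> y; rewrite -[RHS](pq_pentagonal pq o).
by rewrite /double /half [RHS]mulC [mul (mul o y) o]mulC.
Qed.

Lemma halfK : cancel half double.
Proof. by move=> y; rewrite /double -halfM -/(double y) doubleK. Qed.

Lemma half_padd x y : half (padd x y) = mul x y.
Proof. exact: doubleK. Qed.

Lemma paddC : commutative padd.
Proof. by move=> x y; rewrite /padd mulC. Qed.

Lemma padd0 : left_id o padd.
Proof. exact: halfK. Qed.

(** Halving both sides twice turns associativity into
    (ox)(yz) = (xy)(oz). *)
Lemma paddA : associative padd.
Proof.
move=> x y z; do 2!apply: (can_inj halfK); rewrite !half_padd.
rewrite (halfM x) (halfM _ z) !half_padd.
by rewrite /half [mul o x]mulC mul_medial.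
Qed.

Lemma paddI x : injective (padd x).
Proof. by move=> y z /(can_inj doubleK)/pq_mulI. Qed.

Lemma paddxx x : padd x x = double x.
Proof. by rewrite /padd mulxx. Qed.

Lemma double_nmul n x : double (nmul n x) = nmul (n + n) x.
Proof. by rewrite (nmulDl _ _ _ paddA padd0) paddxx. Qed.

Lemma double_nmul1 x : double x = nmul 2 x.
Proof. by rewrite -(double_nmul 1) (nmul1 _ _ _ paddC padd0). Qed.

(** The term defining [double] makes 8x a midpoint, hence 16x a sum, of x
    and 4x. *)
Lemma nmul16 x : nmul 16 x = nmul 5 x.
Proof.
have nmul4 : nmul 4 x = double (double x) by rewrite (double_nmul1 x) double_nmul.
(* 8x is the product of x, which is half of half of 4x, with 4x. *)
have nmul8 : nmul 8 x = mul x (nmul 4 x).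
  by rewrite -(double_nmul 4) {1}/double {1}nmul4 !doubleK.
by rewrite -(double_nmul 8) nmul8.
Qed.

Lemma nmul11 x : nmul 11 x = o.
Proof.
apply: (paddI (nmul 5 x)); rewrite -(nmulDl _ _ _ paddA padd0).
by rewrite [RHS]paddC padd0 nmul16.
Qed.

Lemma half_nmul6 x : half x = nmul 6 x.
Proof.
apply: (can_inj doubleK); rewrite halfK double_nmul.
by rewrite -[nmul _ x]/(padd x (nmul 11 x)) nmul11 paddC padd0.
Qed.

Lemma mul_nmul6 x y : mul x y = padd (nmul 6 x) (nmul 6 y).
Proof. by rewrite -!half_nmul6 /padd -halfM halfK. Qed.

Lemma padd_abelian_group : abelian_group o (nmul 10) padd.
Proof.
split; [exact: paddA | exact: paddC | exact: padd0 |].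
by move=> x; rewrite paddC; exact: nmul11.
Qed.

End PentagonalGroup.

Theorem proposition3p9 (Q : Type) (Q_nonempty : inhabited Q)
    (mul : Q -> Q -> Q) :
  (pentagonal_quasigroup mul /\ commutative mul) <->
  (exists (zero : Q) (opp : Q -> Q) (add : Q -> Q -> Q),
      [/\ abelian_group zero opp add,
          (forall x, nmul zero add 11 x = zero) &
          (forall x y, mul x y = add (nmul zero add 6 x) (nmul zero add 6 y))]).
Proof.
split=> [[pq mulC] | [zero [opp [add [ag exp11 mulE]]]]].
  have [o] := Q_nonempty.
  exists o, (nmul o (padd _ mul o) 10), (padd _ mul o); split.
  - exact: padd_abelian_group.
  - exact: nmul11.
  - exact: mul_nmul6.
split; last by move=> x y; rewrite !mulE; exact: midpointC ag _ _.
have [[solve_l solve_r] mxx med pent] :=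
  midpoint_pentagonal_quasigroup _ _ _ _ ag exp11.
split.
- by split=> a b; [have [x [e u]] := solve_l a b | have [x [e u]] := solve_r a b];
    exists x; split=> [|y]; rewrite mulE //; exact: u.
- by move=> x; rewrite mulE.
- by move=> x y z u; rewrite !mulE.
- by move=> x y; rewrite !mulE.
Qed.
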